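(* Let $(M_1,g,J_1)$ be an almost Hermitian manifold, let $M_2$ be a proper pointwise slant immersed submanifold of $(M_1,g,J_1)$ with slant function $\theta_1$, let $J_2:=\sec\theta_1\cdot T_1$, where $T_1v$ denotes the component of $J_1v$ tangent to $M_2$ for $v$ tangent to $M_2$, and let $M_3$ be a pointwise slant immersed submanifold of the almost Hermitian manifold $(M_2,g,J_2)$ with slant function $\theta_2$. Then the slant function $\tilde\theta_1=\arccos(\cos\theta_1\cos\theta_2)$ of $M_3$ as a pointwise slant submanifold of $(M_1,g,J_1)$ satisfies $$\tilde\theta_1\geq\max\{\theta_1,\theta_2\}$$ on $M_3$.
   Context: An almost complex structure on a manifold is an endomorphism $J$ of the tangent bundle with $J^2=-I$; if it is skew-symmetric with respect to a Riemannian metric $g$, then $(g,J)$ is an almost Hermitian structure, and the manifold equipped with $(g,J)$ is an almost Hermitian manifold. All immersions are assumed injective, and the same symbol denotes a metric and the induced metric on a submanifold. In the formulas, $\theta_1$ is restricted to $M_3$. An immersed submanifold $M$ of an almost Hermitian manifold $(\bar M,\bar g,\bar J)$ is a pointwise slant submanifold with slant function $\theta$, $\theta(x)\in(0,\frac{\pi}{2}]$ for all $x\in M$, if, for every $x\in M$ and every nonzero $v\in T_xM$, the angle between $\bar Jv$ and $T_xM$ does not depend on $v$ but only on $x$; its value is $\theta(x)$. Equivalently, if $Tv$ is the component of $\bar Jv$ tangent to $M$, then $\Vert Tv\Vert^2=\cos^2\theta(x)\Vert v\Vert^2$ for all $v\in T_xM$. It is a proper pointwise slant submanifold if moreover $\theta(x)\neq\frac{\pi}{2}$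 for all $x\in M$. *)

(* Defs.v *)
From mathcomp Require Import all_boot all_order all_algebra.
From mathcomp Require Import all_classical all_reals all_analysis.

Set Implicit Arguments.
Unset Strict Implicit.
Unset Printing Implicit Defensive.

Import Order.TTheory GRing.Theory Num.Theory.
Import numFieldNormedType.Exports.

Local Open Scope classical_set_scope.
Local Open Scope ring_scope.

(* Only meant for open [U]: the derivatives are those of [f] on the whole
   space, so that they are determined by the values of [f] on [U]. *)
Fixpoint Ck (R : realType) (V W : normedModType R) (k : nat)
    (U : set V) (f : V -> W) : Prop :=
  match k with
  | 0 => forall x, U x -> {for x, continuous f}
  | k'.+1 => (forall x, U x -> differentiable f x)
             /\ forall v : V, Ck k' U (fun x => 'D_v f x)
  end.

Definition smooth_on (R : realType) (V W : normedModType R)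
    (U : set V) (f : V -> W) : Prop := forall k, Ck k U f.

(* [chart_inv] is a total function, but it is only relevant on the open set
   [chart_map @` chart_dom]. *)
Record chart (R : realType) (n : nat) (M : topologicalType) := Chart {
  chart_dom : set M ;
  chart_map :> M -> 'rV[R]_n ;
  chart_inv : 'rV[R]_n -> M ;
  chart_dom_open : open chart_dom ;
  chart_img_open : open (chart_map @` chart_dom) ;
  chart_mapK : forall x, chart_dom x -> chart_inv (chart_map x) = x ;
  chart_map_continuous :
    forall x, chart_dom x -> {for x, continuous chart_map} ;
  chart_inv_continuous :
    forall y, (chart_map @` chart_dom) y -> {for y, continuous chart_inv} }.

(* The atlas need not be maximal.  [chart_at] selects a chart around each
   point; it only serves to give a concrete model of the tangent spaces. *)
Record manifold (R : realType) (n : nat) := Manifold {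
  carrier :> topologicalType ;
  carrier_hausdorff : hausdorff_space carrier ;
  carrier_second_countable : @second_countable carrier ;
  atlas : set (chart R n carrier) ;
  atlas_compatible : forall c d, atlas c -> atlas d ->
    smooth_on (c @` (chart_dom c `&` chart_dom d)) (d \o chart_inv c) ;
  chart_at : carrier -> chart R n carrier ;
  chart_at_atlas : forall x, atlas (chart_at x) ;
  chart_at_dom : forall x, chart_dom (chart_at x) x }.

(* A tangent vector at [x] is represented by its components in the chart
   [chart_at x]. *)
Definition tangent (R : realType) (n : nat) (M : manifold R n) (x : M) :
  normedModType R := 'rV[R]_n.

(* The i-th coordinate vector of the chart [c], as a tangent vector at [x]. *)
Definition frame (R : realType) (n : nat) (M : manifold R n)
    (c : chart R n M) (x : M) (i : 'I_n) : tangent x :=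
  'd (chart_at x \o chart_inv c : 'rV[R]_n -> 'rV[R]_n) (c x) (delta_mx 0 i).

(* The components of the tangent vector [v] with respect to [frame c x]. *)
Definition coordinates (R : realType) (n : nat) (M : manifold R n)
    (c : chart R n M) (x : M) (v : tangent x) : 'rV[R]_n :=
  'd (c \o chart_inv (chart_at x) : 'rV[R]_n -> 'rV[R]_n) (chart_at x x) v.

Definition smooth_map (R : realType) (m n : nat)
    (M : manifold R m) (N : manifold R n) (f : M -> N) : Prop :=
  continuous f /\
  forall (c : chart R m M) (d : chart R n N), atlas c -> atlas d ->
    smooth_on (c @` (chart_dom c `&` f @^-1` chart_dom d))
              (d \o f \o chart_inv c).

Definition tangent_map (R : realType) (m n : nat)
    (M : manifold R m) (N : manifold R n) (f : M -> N) (x : M) :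
    tangent x -> tangent (f x) :=
  'd (chart_at (f x) \o f \o chart_inv (chart_at x) : 'rV[R]_m -> 'rV[R]_n)
     (chart_at x x).

Definition injective_immersion (R : realType) (m n : nat)
    (M : manifold R m) (N : manifold R n) (f : M -> N) : Prop :=
  [/\ smooth_map f, injective f & forall x : M, injective (tangent_map f (x := x))].

Definition form_field (R : realType) (n : nat) (M : manifold R n) :=
  forall x : M, tangent x -> tangent x -> R.

Definition endo_field (R : realType) (n : nat) (M : manifold R n) :=
  forall x : M, tangent x -> tangent x.

Definition riemannian_metric (R : realType) (n : nat) (M : manifold R n)
    (g : form_field M) : Prop :=
  [/\ forall (x : M) (v : tangent x), scalar (fun u => g x u v),
      forall (x : M) (u v : tangent x), g x u v = g x v u,
      forall (x : M) (u : tangent x), u != 0 -> 0 < g x u u &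
      forall (c : chart R n M) (i j : 'I_n), atlas c ->
        smooth_on (c @` chart_dom c)
          (fun y => g (chart_inv c y) (frame c (chart_inv c y) i)
                      (frame c (chart_inv c y) j) : R^o)].

Definition almost_complex_structure (R : realType) (n : nat)
    (M : manifold R n) (J : endo_field M) : Prop :=
  [/\ forall x : M, linear (J x),
      forall (x : M) (v : tangent x), J x (J x v) = - v &
      forall (c : chart R n M) (i : 'I_n), atlas c ->
        smooth_on (c @` chart_dom c)
          (fun y => coordinates c
                      (J (chart_inv c y) (frame c (chart_inv c y) i)))].

Definition almost_hermitian (R : realType) (n : nat) (M : manifold R n)
    (g : form_field M) (J : endo_field M) : Prop :=
  [/\ riemannian_metric g, almost_complex_structure J &
      forall (x : M) (u v : tangent x), g x (J x u) v = - g x u (J x v)].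

Definition induced_metric (R : realType) (m n : nat) (M : manifold R m)
    (N : manifold R n) (f : M -> N) (g : form_field N) : form_field M :=
  fun x u v => g (f x) (tangent_map f u) (tangent_map f v).

Definition gnorm (R : realType) (n : nat) (M : manifold R n)
    (g : form_field M) (x : M) (v : tangent x) : R := Num.sqrt (g x v v).

(* As [0^-1 = 0] and [acos 0 = pi / 2], the angle between a vector and the
   null vector is [pi / 2]. *)
Definition angle (R : realType) (n : nat) (M : manifold R n)
    (g : form_field M) (x : M) (u v : tangent x) : R :=
  acos (g x u v / (gnorm g u * gnorm g v)).

(* The component tangent to the submanifold [f : M -> N] of a vector [w] of the
   ambient space: the vector of [M] mapped by the differential of [f] to the
   orthogonal projection of [w].  For an immersion and a Riemannian metric [g],
   it exists and is unique. *)
Definition tangential (R : realType) (m n : nat) (M : manifold R m)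
    (N : manifold R n) (g : form_field N) (f : M -> N) (x : M)
    (w : tangent (f x)) : tangent x :=
  xget 0 [set u : tangent x | forall z : tangent x,
    g (f x) (w - tangent_map f u) (tangent_map f z) = 0].

Definition tangential_endo (R : realType) (m n : nat) (M : manifold R m)
    (N : manifold R n) (g : form_field N) (J : endo_field N) (f : M -> N) :
    endo_field M :=
  fun x v => tangential g (J (f x) (tangent_map f v)).

(* The angle between a vector [w] of the ambient space and the tangent space
   of the submanifold: the angle between [w] and its orthogonal projection;
   it is [pi / 2] when [w] is normal to the submanifold. *)
Definition angle_to_tangent (R : realType) (m n : nat) (M : manifold R m)
    (N : manifold R n) (g : form_field N) (f : M -> N) (x : M)
    (w : tangent (f x)) : R :=
  angle g w (tangent_map f (tangential g w)).

Definition pointwise_slant (R : realType) (m n : nat) (M : manifold R m)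
    (N : manifold R n) (g : form_field N) (J : endo_field N) (f : M -> N)
    (theta : M -> R) : Prop :=
  [/\ injective_immersion f,
      forall x : M, 0 < theta x <= pi / 2 &
      forall (x : M) (v : tangent x), v != 0 ->
        angle_to_tangent g (J (f x) (tangent_map f v)) = theta x].

Definition proper_pointwise_slant (R : realType) (m n : nat)
    (M : manifold R m) (N : manifold R n) (g : form_field N)
    (J : endo_field N) (f : M -> N) (theta : M -> R) : Prop :=
  pointwise_slant g J f theta /\ forall x : M, theta x != pi / 2.

Definition slant_endo (R : realType) (m n : nat) (M : manifold R m)
    (N : manifold R n) (g : form_field N) (J : endo_field N) (f : M -> N)
    (theta : M -> R) : endo_field M :=
  fun x v => (cos (theta x))^-1 *: tangential_endo g J f v.

(* Main.v *)
Require Import Defs.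
From HB Require Import structures.
From mathcomp Require Import all_boot all_order all_algebra.
From mathcomp Require Import all_classical all_reals all_analysis.
From mathcomp Require Import lra.

Set Implicit Arguments.
Unset Strict Implicit.
Unset Printing Implicit Defensive.

Import Order.TTheory GRing.Theory Num.Theory.
Import numFieldNormedType.Exports.

Local Open Scope classical_set_scope.
Local Open Scope ring_scope.

(** Fix [x] in M3, a nonzero vector [v] tangent to M3 at [x], and let [w] be the
    image under J1 of [v] seen as a tangent vector of M1.  Since T M3 lies in
    T M2, the orthogonal projection of [w] to T M3 is obtained by projecting
    first to T M2 and then to T M3 ([tangential_comp]).  The first projection
    gives [T1 v] and shrinks the length by [cos theta1].  The vector [T1 v] is
    [cos theta1] times [J2 v], so that the second projection, being
    homogeneous, shrinks the length by [cos theta2] because M3 is slant for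
    [J2].  Hence the total ratio is [cos theta1 * cos theta2]
    ([gnorm_projection_comp]), and the angle between [w] and T M3 is the
    arccosine of the ratio between the length of its projection and its own
    length ([angle_to_tangentE]).  As both cosines are in [0, 1], their product
    is below each of them; the arccosine is decreasing, whence the inequality.

    The induced metric on M2 is an inner product on each tangent space because
    the differential of an immersion is injective, and the orthogonal projection
    exists since the Gram matrix of an injective linear map is invertible
    ([orthogonal_projection_exists]).

    It remains that the composite of two injective immersions is an injective
    immersion.  In charts this is the chain rule together with the fact that
    functions of class C^k are stable under composition ([Ck_comp]), proved by
    induction on k from the expansion of a directional derivative of a
    composite into products of directional derivatives. *)

(** * Differentials *)

Section Differentials.
Context {R : realType}.

Lemma near_eq_differentiable (V W : normedModType R) (f g : V -> W) (x : V) :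
  (\near x, f x = g x) -> differentiable f x ->
  differentiable g x /\ 'd g x = 'd f x :> (V -> W).
Proof.
move=> fg df.
have fgx : f x = g x := nbhs_singleton fg.
have fg0 : \forall y \near 0, f (y + x) = g (y + x).
  by move: fg; rewrite (near_shift 0) subr0.
have E : g \o shift x = cst (g x) + 'd f x +o_ 0 id.
  have := diff_locally df => /eqaddoP Ef.
  apply/eqaddoP => e e0; have := Ef e e0.
  by apply: filter_app; apply: filterS fg0 => y fgy; rewrite !fctE /= -fgx fgy.
have dfc := diff_continuous df.
have dgE : 'd g x = 'd f x :> (V -> W) by exact: diff_unique.
by split=> //; apply/diff_locallyP; rewrite dgE; split.
Qed.

(** The base point of [g] is a variable [y], because a chart expression for
    [f] reaches it only up to the rewriting of a chart followed by its
    inverse. *)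
Lemma near_diff_comp (U V W : normedModType R) (f : U -> V) (g : V -> W)
    (h : U -> W) (x : U) (y : V) :
  f x = y -> differentiable f x -> differentiable g y ->
  (\near x, (g \o f) x = h x) -> 'd h x = 'd g y \o 'd f x :> (U -> W).
Proof.
move=> <- df dg gfh; have dgf := differentiable_comp df dg.
by have [_ ->] := near_eq_differentiable gfh dgf; exact: diff_comp.
Qed.

Lemma scale_is_bilinear (W : normedModType R) :
  bilinear_for
    (GRing.Scale.Law.clone _ _ *:%R _) (GRing.Scale.Law.clone _ _ *:%R _)
    (fun (a : R^o) (w : W) => a *: w).
Proof.
split=> [w|a] b x y /=; first by rewrite scalerDl scalerA.
by rewrite scalerDr !scalerA mulrC.
Qed.

(** The Leibniz rule is the differential of the bilinear map [a *: w], composed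
    with the pair [(a, f)]. *)
Lemma differentiable_scale (V W : normedModType R) (a : V -> R^o) (f : V -> W)
    (x : V) : differentiable a x -> differentiable f x ->
  differentiable (fun y => a y *: f y) x /\
  forall v, 'D_v (fun y => a y *: f y) x = a x *: 'D_v f x + 'D_v a x *: f x.
Proof.
move=> da df.
pose bM := bilinear_isBilinear.Build R R^o W W _ _ _ (@scale_is_bilinear W).
pose b : {bilinear R^o -> W -> W} :=
  HB.pack (fun (a : R^o) (w : W) => a *: w) bM.
have bc : continuous (fun p : R^o * W => b p.1 p.2).
  by move=> p; apply: cvgZ; [exact: cvg_fst|exact: cvg_snd].
have db := differentiable_bilin (a x, f x) bc.
have dp := differentiable_pair da df.
have dc := differentiable_comp dp db.
split=> // v; rewrite !deriveE //.
have -> : (fun y => a y *: f y)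
    = (fun p => b p.1 p.2) \o (fun y => (a y, f y)) by [].
by rewrite diff_comp // -[LHS]/('d _ _ ('d _ x v)) (diff_bilin _ bc) diff_pair.
Qed.

End Differentials.

(** * Functions of class C^k *)

Section Ck.
Context {R : realType}.
Implicit Types V W : normedModType R.

(** [Ck k U f] is a conjunction of conditions at the single points of [U], so it
    may be verified with a different set around each point. *)
Lemma Ck_local V W k (U : set V) (f : V -> W) :
  (forall x, U x -> exists2 A : set V, A x & Ck k A f) -> Ck k U f.
Proof.
elim: k f => [|k IH] f loc /=; first by move=> x /loc [A Ax]; apply.
split=> [x /loc [A Ax [dA _]]|v]; first exact: dA.
by apply: IH => x /loc[A Ax [_ DA]]; exists A; last exact: DA.
Qed.

Lemma Ck_subset V W k (A U : set V) (f : V -> W) :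
  A `<=` U -> Ck k U f -> Ck k A f.
Proof. by move=> AU fU; apply: Ck_local => x /AU Ux; exists U. Qed.

(** Openness of [U] is essential: derivatives see the values of the functions
    around a point, not only at the point. *)
Lemma Ck_ext V W k (U : set V) (f g : V -> W) :
  open U -> (forall x, U x -> f x = g x) -> Ck k U f -> Ck k U g.
Proof.
move=> Uo; have near_fg h1 h2 x : (forall x, U x -> h1 x = h2 x) -> U x ->
    \near x, h1 x = h2 x :> W.
  by move=> h12 Ux; apply: filterS h12 _; exact: open_nbhs_nbhs.
elim: k f g => [|k IH] f g fg /=.
  move=> fc x Ux; rewrite /prop_for /continuous_at -(fg x Ux).
  by apply: cvg_trans (fc x Ux); apply: near_eq_cvg; exact: near_fg.
move=> [df Df]; split=> [x Ux|v].
  by have [] := near_eq_differentiable (near_fg _ _ _ fg Ux) (df x Ux).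
by apply: IH (Df v) => x Ux; apply: near_eq_derive; exact: near_fg.
Qed.

Lemma CkS V W k (U : set V) (f : V -> W) : Ck k.+1 U f -> Ck k U f.
Proof.
elim: k f => [|k IH] f [df Df].
  by move=> x /df; exact: differentiable_continuous.
by split=> // v; apply: IH; exact: Df.
Qed.

Lemma Ck_cst V W k (U : set V) (w : W) : Ck k U (fun _ => w).
Proof.
elim: k w => [|k IH] w /=; first by move=> x _; exact: cst_continuous.
split=> [x _|v]; first exact: differentiable_cst.
by under eq_fun do rewrite (derive_cst w); exact: IH.
Qed.

Lemma Ck_add V W k (U : set V) (f g : V -> W) : open U ->
  Ck k U f -> Ck k U g -> Ck k U (fun x => f x + g x).
Proof.
move=> Uo; elim: k f g => [|k IH] f g /=.
  by move=> fc gc x Ux; apply: cvgD; [exact: fc|exact: gc].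
move=> [df Df] [dg Dg]; split=> [x Ux|v].
  by apply: differentiableD; [exact: df|exact: dg].
apply: (Ck_ext (f := fun x => 'D_v f x + 'D_v g x)) => // [x Ux|]; last exact: IH.
by rewrite deriveD //; apply: diff_derivable; [exact: df|exact: dg].
Qed.

Lemma Ck_sum V W k (U : set V) (I : Type) (r : seq I) (F : I -> V -> W) :
  open U -> (forall i, Ck k U (F i)) -> Ck k U (fun x => \sum_(i <- r) F i x).
Proof.
move=> Uo FC; elim: r => [|i r IH].
  by under eq_fun do rewrite big_nil; exact: Ck_cst.
by under eq_fun do rewrite big_cons; exact: Ck_add.
Qed.

Lemma Ck_scale V W k (U : set V) (a : V -> R^o) (f : V -> W) : open U ->
  Ck k U a -> Ck k U f -> Ck k U (fun x => a x *: f x).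
Proof.
move=> Uo; elim: k a f => [|k IH] a f.
  by move=> ac fc x Ux; exact: cvgZ (ac x Ux) (fc x Ux).
move=> aC fC; have [[da Da] [df Df]] := (aC, fC).
split=> [x Ux|v].
  by have [] := differentiable_scale (da x Ux) (df x Ux).
apply: (Ck_ext (f := fun x => a x *: 'D_v f x + 'D_v a x *: f x)) => // [x Ux|].
  by have [_ ->] := differentiable_scale (da x Ux) (df x Ux).
apply: Ck_add => //; apply: IH; [exact: CkS|exact: Df|exact: Da|exact: CkS].
Qed.

Lemma Ck_coord V n k (U : set V) (f : V -> 'rV[R]_n) (i : 'I_n) : open U ->
  Ck k U f -> Ck k U (fun x => f x 0 i : R^o).
Proof.
move=> Uo; elim: k f => [|k IH] f /=.
  move=> fc x Ux.
  apply: (@continuous_comp _ _ _ f (fun A : 'rV[R]_n => A 0 i : R^o)).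
    exact: fc.
  exact: coord_continuous.
move=> [df Df]; split=> [x Ux|v].
  exact: (differentiable_comp (df x Ux) (differentiable_coord _ _ _)).
apply: Ck_ext (IH _ (Df v)) => // x Ux.
by rewrite derive_mx ?mxE //; apply: diff_derivable; exact: df.
Qed.

(** Expanding the inner derivative in the standard basis separates the factors:
    each summand is a product of two functions whose regularity is known
    separately, which a differential applied to a moving vector is not. *)
Lemma derive_comp_coord V W n (f : 'rV[R]_n -> W) (g : V -> 'rV[R]_n)
    (x v : V) :
  differentiable g x -> differentiable f (g x) ->
  'D_v (f \o g) x = \sum_i ('D_v g x) 0 i *: 'D_(delta_mx 0 i) f (g x).
Proof.
move=> dg df; rewrite deriveE; last exact: differentiable_comp.
rewrite diff_comp //= -(deriveE v dg); move: ('D_v g x) => w.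
rewrite {1}[w]row_sum_delta linear_sum.
by apply: eq_bigr => i _; rewrite linearZ deriveE.
Qed.

(** In each summand of [derive_comp_coord] the factor coming from [f] is again a
    composite with [g], of a function of class C^k, so induction on k applies;
    the factor coming from [g] is already of class C^k. *)
Lemma Ck_comp V W n k (U : set V) (A : set 'rV[R]_n) (f : 'rV[R]_n -> W)
    (g : V -> 'rV[R]_n) : open U -> (forall x, U x -> A (g x)) ->
  Ck k A f -> Ck k U g -> Ck k U (f \o g).
Proof.
move=> Uo UA; elim: k f => [|k IH] f fC gC.
  by move=> x Ux; apply: continuous_comp; [exact: gC|apply: fC; exact: UA].
have [[df Df] [dg Dg]] := (fC, gC).
split=> [x Ux|v].
  by apply: differentiable_comp; [exact: dg|apply: df; exact: UA].
apply: (Ck_ext (f := fun x =>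
    \sum_i ('D_v g x) 0 i *: ('D_(delta_mx 0 i) f \o g) x)) => // [x Ux|].
  by rewrite derive_comp_coord //; [exact: dg|apply: df; exact: UA].
apply: Ck_sum => // i; apply: Ck_scale => //.
  by apply: Ck_coord; last exact: Dg.
by apply: IH; [exact: Df|exact: CkS].
Qed.

End Ck.

(** * Composition of injective immersions *)

Section Charts.
Context {R : realType}.

Lemma open_chart_image n (M : topologicalType) (c : chart R n M) (W : set M) :
  open W -> open (c @` (chart_dom c `&` W)).
Proof.
move=> Wo; rewrite openE => _ [x [cx Wx] <-].
have cdx : (c @` chart_dom c) (c x) by exists x.
have ni : nbhs (c x) (chart_inv c @^-1` W).
  apply: (chart_inv_continuous cdx); rewrite chart_mapK //.
  exact: open_nbhs_nbhs.
have nd : nbhs (c x) (c @` chart_dom c).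
  by apply: open_nbhs_nbhs; split; [exact: chart_img_open|].
apply: filterS2 nd ni => _ [z cz <-]; rewrite /preimage /= chart_mapK // => Wz.
by exists z.
Qed.

(** Around a point [x] the chart expression of [g \o f] is the composite of the
    chart expressions of [f] and [g] through a chart around [f x]; this holds
    only on a neighbourhood depending on [x], hence the use of [Ck_local]. *)
Lemma smooth_map_comp m n p (M : manifold R m) (N : manifold R n)
    (P : manifold R p) (f : M -> N) (g : N -> P) :
  smooth_map f -> smooth_map g -> smooth_map (g \o f).
Proof.
move=> [fc fS] [gc gS]; have gfc : continuous (g \o f).
  by move=> x; apply: continuous_comp; [exact: fc|exact: gc].
split=> // c d ac ad k; apply: Ck_local => _ [x [cx dx] <-].
set e := chart_at (f x); have ae : atlas e := chart_at_atlas _.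
pose B := chart_dom e `&` g @^-1` chart_dom d.
have Bo : open B.
  apply: openI; first exact: chart_dom_open.
  by apply: open_comp => [? _|]; [exact: gc|exact: chart_dom_open].
have fBo : open (f @^-1` B) by apply: open_comp => // ? _; exact: fc.
pose A := c @` (chart_dom c `&` f @^-1` B).
have Ao : open A by exact: open_chart_image.
exists A; first by exists x => //; split=> //; split=> //; exact: chart_at_dom.
apply: (Ck_ext (f := (d \o g \o chart_inv e) \o (e \o f \o chart_inv c))) => //.
  by move=> _ [z [cz [ez dz]] <-] /=; rewrite chart_mapK // chart_mapK.
apply: (Ck_comp (A := e @` B)) => //.
- by move=> _ [z [cz Bz] <-]; exists (f z) => //=; rewrite chart_mapK.
- exact: gS.
- apply: Ck_subset (fS c e ac ae k).
  by apply: image_subset => z [cz [ez _]].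
Qed.

Lemma smooth_map_differentiable m n (M : manifold R m) (N : manifold R n)
    (f : M -> N) (x : M) : smooth_map f ->
  differentiable (chart_at (f x) \o f \o chart_inv (chart_at x)
    : 'rV[R]_m -> 'rV[R]_n) (chart_at x x).
Proof.
move=> [_ /(_ _ _ (chart_at_atlas x) (chart_at_atlas (f x)) 1%N) [df _]].
by apply: df; exists x => //; split; exact: chart_at_dom.
Qed.

Lemma tangent_map_comp m n p (M : manifold R m) (N : manifold R n)
    (P : manifold R p) (f : M -> N) (g : N -> P) (x : M) (v : tangent x) :
  smooth_map f -> smooth_map g ->
  tangent_map (g \o f) v = tangent_map g (tangent_map f v).
Proof.
move=> fS gS.
have df := smooth_map_differentiable x fS.
have dg := smooth_map_differentiable (f x) gS.
set c := chart_at x in df *; set e := chart_at (f x) in df dg *.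
have efx : (e \o f \o chart_inv c) (c x) = e (f x).
  by rewrite /= chart_mapK //; exact: chart_at_dom.
have near_gf : \forall y \near c x,
    ((chart_at (g (f x)) \o g \o chart_inv e) \o (e \o f \o chart_inv c)) y
      = (chart_at ((g \o f) x) \o (g \o f) \o chart_inv c) y.
  have : nbhs (c x) (c @` (chart_dom c `&` f @^-1` chart_dom e)).
    apply: open_nbhs_nbhs; split.
      apply: open_chart_image; apply: open_comp; last exact: chart_dom_open.
      by move=> ? _; exact: fS.1.
    by exists x => //; split; exact: chart_at_dom.
  by apply: filterS => _ [z [cz ez] <-] /=; rewrite chart_mapK // chart_mapK.
by rewrite /tangent_map (near_diff_comp efx df dg near_gf).
Qed.

Lemma injective_immersion_comp m n p (M : manifold R m) (N : manifold R n)
    (P : manifold R p) (f : M -> N) (g : N -> P) :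
  injective_immersion f -> injective_immersion g -> injective_immersion (g \o f).
Proof.
move=> [fS fi dfi] [gS gi dgi]; split; first exact: smooth_map_comp.
  exact: inj_comp.
move=> x u v.
by rewrite (tangent_map_comp u fS gS) (tangent_map_comp v fS gS) => /dgi /dfi.
Qed.

End Charts.

(** * Inner products and orthogonal projections *)

Section InnerProduct.
Context {R : realType}.

Definition inner_product (V : lmodType R) (B : V -> V -> R) : Prop :=
  [/\ forall v, scalar (fun u => B u v),
      forall u v, B u v = B v u &
      forall u, u != 0 -> 0 < B u u].

Section Theory.
Variables (V : lmodType R) (B : V -> V -> R).
Hypothesis ipB : inner_product B.

Lemma ipC u v : B u v = B v u. Proof. by case: ipB. Qed.

Lemma ipPl a u v w : B (a *: u + v) w = a * B u w + B v w.
Proof. by case: ipB => lin _ _; exact: lin. Qed.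

Lemma ip0l v : B 0 v = 0.
Proof.
by have := ipPl (-1) 0 0 v; rewrite scaler0 addr0 mulN1r addNr.
Qed.

Lemma ipDl u v w : B (u + v) w = B u w + B v w.
Proof. by have := ipPl 1 u v w; rewrite scale1r mul1r. Qed.

Lemma ipZl a u w : B (a *: u) w = a * B u w.
Proof. by have := ipPl a u 0 w; rewrite addr0 ip0l addr0. Qed.

Lemma ipBl u v w : B (u - v) w = B u w - B v w.
Proof. by rewrite -[- v]scaleN1r ipDl ipZl mulN1r. Qed.

Lemma ip_suml m (F : 'I_m -> V) w : B (\sum_i F i) w = \sum_i B (F i) w.
Proof. by apply: (big_morph (B^~ w)) => [u v|]; rewrite (ipDl, ip0l). Qed.

Lemma ip_ge0 u : 0 <= B u u.
Proof.
by have [->|] := eqVneq u 0; [rewrite ip0l|case: ipB => _ _ p /p/ltW].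
Qed.

Lemma ip_eq0 u : B u u = 0 -> u = 0.
Proof.
by case: ipB => _ _ pos Bu; apply/eqP; apply: contraT => /pos; rewrite Bu ltxx.
Qed.

(** The coefficients of the projection solve a linear system whose matrix is the
    Gram matrix of the images of the standard basis; a vector [u] in its kernel
    satisfies [B (L u) (L u) = 0], so the matrix is invertible. *)
Lemma orthogonal_projection_exists m (L : {linear 'rV[R]_m -> V}) (w : V) :
  injective L -> exists u, forall z, B (w - L u) (L z) = 0.
Proof.
move=> Linj.
have LE u : L u = \sum_i u 0 i *: L (delta_mx 0 i).
  rewrite {1}[u]row_sum_delta linear_sum.
  by apply: eq_bigr => i _; rewrite linearZ.
pose G : 'M[R]_m := \matrix_(i, j) B (L (delta_mx 0 i)) (L (delta_mx 0 j)).
have GE (u : 'rV_m) j : (u *m G) 0 j = B (L u) (L (delta_mx 0 j)).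
  by rewrite mxE LE ip_suml; apply: eq_bigr => i _; rewrite mxE ipZl.
have Gunit : G \in unitmx.
  rewrite -row_free_unit -kermx_eq0; apply/rowV0P => u /sub_kermxP uG0.
  apply: Linj; rewrite linear0; apply: ip_eq0.
  rewrite {2}LE ipC ip_suml big1 // => j _.
  by rewrite ipZl ipC -GE uG0 mxE mulr0.
pose b : 'rV[R]_m := \row_j B w (L (delta_mx 0 j)).
exists (b *m invmx G) => z; rewrite (LE z) ipC ip_suml big1 // => j _.
by rewrite ipZl ipC ipBl -GE mulmxKV // mxE subrr mulr0.
Qed.

Lemma orthogonal_projection_unique (U : lmodType R) (L : {linear U -> V})
    (w : V) (u v : U) :
  injective L -> (forall z, B (w - L u) (L z) = 0) ->
  (forall z, B (w - L v) (L z) = 0) -> u = v.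
Proof.
move=> Linj Pu Pv; apply: Linj; apply/eqP; rewrite -subr_eq0; apply/eqP.
apply: ip_eq0; rewrite -{2}linearB ipBl; apply/eqP; rewrite subr_eq0.
have /eqP := Pu (u - v); rewrite ipBl subr_eq0 => /eqP <-.
by have := Pv (u - v); rewrite ipBl => /eqP; rewrite subr_eq0.
Qed.

End Theory.

Lemma inner_product_comp (U V : lmodType R) (B : V -> V -> R)
    (L : {linear U -> V}) : inner_product B -> injective L ->
  inner_product (fun u v => B (L u) (L v)).
Proof.
move=> ipB Linj; split=> [w a u v|u v|u u0].
- by rewrite linearP ipPl.
- exact: ipC.
- by case: ipB => _ _; apply; rewrite -(inj_eq Linj) linear0 in u0.
Qed.

End InnerProduct.

(** * Projection to a submanifold *)

(** The unqualified name denotes a rewriting rule on finite groups. *)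
Local Notation gnorm := Defs.gnorm.

Section Slant.
Context {R : realType}.

Lemma metric_inner_product n (M : manifold R n) (g : form_field M) (x : M) :
  riemannian_metric g -> inner_product (g x).
Proof. by case=> lin sym pos _; split; [exact: lin|exact: sym|exact: pos]. Qed.

Lemma tangent_mapB m n (M : manifold R m) (N : manifold R n)
    (f : M -> N) (x : M) (u v : tangent x) :
  tangent_map f (u - v) = tangent_map f u - tangent_map f v.
Proof. exact: (linearB ('d _ _)). Qed.

Lemma tangent_mapZ m n (M : manifold R m) (N : manifold R n)
    (f : M -> N) (x : M) (a : R) (u : tangent x) :
  tangent_map f (a *: u) = a *: tangent_map f u.
Proof. exact: (linearZZ ('d _ _)). Qed.

Lemma tangent_map_neq0 m n (M : manifold R m) (N : manifold R n)
    (f : M -> N) (x : M) (u : tangent x) :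
  injective (tangent_map f (x := x)) -> u != 0 -> tangent_map f u != 0.
Proof.
move=> df; apply: contra_neq => fu0; apply: df; rewrite fu0.
exact: (esym (linear0 ('d _ _))).
Qed.

Section Projection.
Context {m n : nat} {M : manifold R m} {N : manifold R n}.
Variables (g : form_field N) (f : M -> N) (x : M).
Arguments g : clear implicits.
Hypothesis ipg : inner_product (g (f x)).
Hypothesis dfI : injective (tangent_map f (x := x)).

Lemma inner_product_induced : inner_product (@induced_metric _ _ _ _ _ f g x).
Proof. exact: inner_product_comp ipg dfI. Qed.

Lemma tangentialP (w : tangent (f x)) (z : tangent x) :
  g (f x) (w - tangent_map f (tangential g w)) (tangent_map f z) = 0.
Proof.
have [u Pu] := orthogonal_projection_exists ipg w dfI.
have := @xgetPex _ 0 [set u : tangent x | forall z : tangent x,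
  g (f x) (w - tangent_map f u) (tangent_map f z) = 0].
by apply; exists u.
Qed.

Lemma tangential_unique (w : tangent (f x)) (u : tangent x) :
  (forall z, g (f x) (w - tangent_map f u) (tangent_map f z) = 0) ->
  tangential g w = u.
Proof.
move=> Pu; exact: (orthogonal_projection_unique ipg dfI (@tangentialP w) Pu).
Qed.

Lemma tangentialZ (a : R) (w : tangent (f x)) :
  tangential g (a *: w) = a *: tangential g w.
Proof.
apply: tangential_unique => z.
by rewrite tangent_mapZ -scalerBr (ipZl ipg) tangentialP mulr0.
Qed.

Lemma gnorm_ge0 (u : tangent (f x)) : 0 <= gnorm g u.
Proof. exact: sqrtr_ge0. Qed.

Lemma gnorm_gt0 (u : tangent (f x)) : u != 0 -> 0 < gnorm g u.
Proof. by rewrite sqrtr_gt0; case: ipg => _ _; apply. Qed.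

Lemma sqr_gnorm (u : tangent (f x)) : gnorm g u ^+ 2 = g (f x) u u.
Proof. by rewrite sqr_sqrtr // (ip_ge0 ipg). Qed.

Lemma gnormZ (a : R) (u : tangent (f x)) : 0 <= a ->
  gnorm g (a *: u) = a * gnorm g u.
Proof.
move=> a0; rewrite /gnorm (ipZl ipg) (ipC ipg) (ipZl ipg) mulrA -expr2.
by rewrite sqrtrM ?sqr_ge0 // sqrtr_sqr ger0_norm.
Qed.

(** A vector minus its projection [p] is orthogonal to [p]. *)
Lemma metric_projection (w : tangent (f x)) :
  g (f x) w (tangent_map f (tangential g w))
    = gnorm g (tangent_map f (tangential g w)) ^+ 2.
Proof.
by apply/eqP; rewrite sqr_gnorm -subr_eq0 -(ipBl ipg) tangentialP.
Qed.

Lemma gnorm_projection_le (w : tangent (f x)) :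
  gnorm g (tangent_map f (tangential g w)) <= gnorm g w.
Proof.
set p := tangent_map f _.
rewrite ler_wsqrtr // -subr_ge0; have := ip_ge0 ipg (w - p).
rewrite (ipBl ipg) [g _ p _](ipC ipg) tangentialP subr0 (ipC ipg) (ipBl ipg).
by rewrite (ipC ipg p) metric_projection sqr_gnorm.
Qed.

(** By [metric_projection] the scalar product of [w] with its projection [p] is
    the squared length of [p]; when [p = 0] both quotients vanish. *)
Lemma angle_to_tangentE (w : tangent (f x)) :
  angle_to_tangent g w
    = acos (gnorm g (tangent_map f (tangential g w)) / gnorm g w).
Proof.
rewrite /angle_to_tangent /angle metric_projection; congr acos.
set a := gnorm g w; set b := gnorm g _.
have [->|b0] := eqVneq b 0; first by rewrite expr0n !mul0r.
by rewrite invfM mulrCA expr2 mulfK // mulrC.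
Qed.

(** The ratio in [angle_to_tangentE] is at most 1, so its arccosine can be
    inverted; this turns a condition on angles into one on lengths. *)
Lemma cos_angle_to_tangent (w : tangent (f x)) : w != 0 ->
  cos (angle_to_tangent g w) * gnorm g w
    = gnorm g (tangent_map f (tangential g w)).
Proof.
move=> /gnorm_gt0 w0; rewrite angle_to_tangentE acosK ?divfK ?gt_eqF //.
rewrite in_itv /=; apply/andP; split.
  by rewrite (le_trans (lerN10 _)) // divr_ge0 ?gnorm_ge0.
by rewrite ler_pdivrMr // mul1r gnorm_projection_le.
Qed.

End Projection.

(** Projecting in two stages: the two residues are orthogonal to the image of
    T M, the first because T M lies in T N, the second for the metric induced
    on N. *)
Lemma tangential_comp m n p (M : manifold R m) (N : manifold R n)
    (P : manifold R p) (g : form_field P) (f : M -> N) (h : N -> P) (x : M)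
    (w : tangent (h (f x))) : inner_product (g (h (f x))) ->
  injective_immersion f -> injective_immersion h ->
  @tangential _ _ _ M P g (h \o f) x w
    = tangential (induced_metric h g) (@tangential _ _ _ N P g h (f x) w).
Proof.
move=> ipg fI hI; have [_ _ dhfI] := injective_immersion_comp fI hI.
have [[fS _ dfI] [hS _ dhI]] := (fI, hI).
apply: (tangential_unique (f := h \o f)) => [//|//|z].
rewrite (tangent_map_comp _ fS hS) (tangent_map_comp z fS hS).
set u := tangential g w; set v := tangential _ u.
have := tangentialP (inner_product_induced ipg (dhI _)) (dfI x) u z.
rewrite -/v /induced_metric tangent_mapB !(ipBl ipg).
move/eqP; rewrite subr_eq0 => /eqP <-.
by rewrite -(ipBl ipg) tangentialP.
Qed.

End Slant.

(** * Slant functions *)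

Section AcosBounds.
Context {R : realType}.

Lemma acos_itv (c : R) : -1 <= c <= 1 -> acos c \in `[0, pi].
Proof. by move=> c11; rewrite in_itv /= acos_ge0 ?acos_lepi. Qed.

Lemma pihalf_itv : (pi / 2 : R) \in `[0, pi].
Proof. by have := pi_gt0 R; rewrite in_itv /= => ?; apply/andP; split; lra. Qed.

Lemma acos_range (c : R) : 0 <= c < 1 -> 0 < acos c <= pi / 2.
Proof.
move=> /andP[c0 c1]; have c11 : -1 <= c <= 1 by apply/andP; split; lra.
rewrite acos_gt0 /=; last by rewrite c1 andbT; case/andP: c11.
by rewrite leNgt -ltr_cos ?pihalf_itv ?acos_itv // cos_pihalf acosK // -leNgt.
Qed.

Lemma acos_ge (t c : R) : t \in `[0, pi] -> -1 <= c -> c <= cos t -> t <= acos c.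
Proof.
move=> t0pi cN1 cct; have c11 : -1 <= c <= 1.
  by rewrite cN1 (le_trans cct (cos_le1 t)).
by rewrite leNgt -ltr_cos ?acos_itv // acosK // -leNgt.
Qed.

End AcosBounds.

Lemma almost_complex_neq0 (R : realType) n (M : manifold R n) (J : endo_field M)
    (x : M) (v : tangent x) :
  almost_complex_structure J -> v != 0 -> J x v != 0.
Proof.
move=> [lin JJ _]; apply: contra_neq => Jv0.
have J0 : J x 0 = 0.
  by have := lin x (-1) 0 0; rewrite scaler0 addr0 scaleN1r addNr.
by have /eqP := JJ x v; rewrite Jv0 J0 eq_sym oppr_eq0 => /eqP.
Qed.

(** Let [u] be [v] seen as a tangent vector of M2, and [t] the component of [w]
    tangent to M2.  The first slant condition gives the length of [t], and the
    second one applies to [J2 u = c^-1 *: t], where [c] is the cosine of the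
    first angle; the factor [c^-1] cancels as
    lengths and projections are homogeneous. *)
Lemma gnorm_projection_comp (R : realType) (n1 n2 n3 : nat)
    (M1 : manifold R n1) (M2 : manifold R n2) (M3 : manifold R n3)
    (g : form_field M1) (J1 : endo_field M1) (i2 : M2 -> M1) (theta1 : M2 -> R)
    (i3 : M3 -> M2) (theta2 : M3 -> R) (x : M3) (v : tangent x) :
  almost_hermitian g J1 -> pointwise_slant g J1 i2 theta1 ->
  pointwise_slant (induced_metric i2 g) (slant_endo g J1 i2 theta1) i3 theta2 ->
  0 < cos (theta1 (i3 x)) -> v != 0 ->
  let w := J1 (i2 (i3 x)) (tangent_map (i2 \o i3) v) in
  gnorm g (tangent_map (i2 \o i3) (@tangential _ _ _ M3 M1 g (i2 \o i3) x w))
    = cos (theta1 (i3 x)) * cos (theta2 x) * gnorm g w.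
Proof.
move=> [gR JR _] [I2 _ S2] [I3 _ S3] c0 v0 w.
have [[S2m _ d2] [S3m _ d3]] := (I2, I3).
have ipg : inner_product (g (i2 (i3 x))) := metric_inner_product _ gR.
have ipg2 := inner_product_induced ipg (d2 _).
have u0 := tangent_map_neq0 (d3 x) v0.
set u := tangent_map i3 v in u0.
have wE : w = J1 (i2 (i3 x)) (tangent_map i2 u).
  by rewrite /w (tangent_map_comp v S3m S2m).
have w0 : w != 0.
  rewrite wE; apply: almost_complex_neq0 => //.
  exact: tangent_map_neq0 (d2 _) u0.
pose t := @tangential _ _ _ M2 M1 g i2 (i3 x) w.
have tE : cos (theta1 (i3 x)) * gnorm g w = gnorm (induced_metric i2 g) t.
  by rewrite -(S2 _ _ u0) -wE (cos_angle_to_tangent ipg (d2 _)).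
have t0 : t != 0.
  apply: contra_eq_neq tE => ->.
  by rewrite {2}/gnorm (ip0l ipg2) sqrtr0 mulf_neq0 ?gt_eqF // (gnorm_gt0 ipg).
set c := cos (theta1 (i3 x)) in c0 tE *.
have JE : slant_endo g J1 i2 theta1 u = c^-1 *: t.
  by rewrite /slant_endo /tangential_endo -wE.
have ct0 : c^-1 *: t != 0 by rewrite scaler_eq0 negb_or invr_eq0 gt_eqF.
(* The second slant condition, read on lengths. *)
have := cos_angle_to_tangent ipg2 (d3 x) ct0.
rewrite -JE (S3 _ _ v0) JE (tangentialZ ipg2 (d3 x)) tangent_mapZ.
have ci0 : 0 <= c^-1 by rewrite invr_ge0 ltW.
rewrite !(gnormZ ipg2) // mulrCA => /(mulfI _) E.
rewrite (tangential_comp w ipg I3 I2) (tangent_map_comp _ S3m S2m) -/t.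
(* The length in M1 of a vector tangent to M2 is its induced length. *)
rewrite -[LHS]/(gnorm (induced_metric i2 g)
  (tangent_map i3 (tangential (induced_metric i2 g) t))).
by rewrite -E ?invr_eq0 ?gt_eqF // -tE mulrCA mulrA.
Qed.

Theorem mainTheorem3 (R : realType) (n1 n2 n3 : nat)
    (M1 : manifold R n1) (M2 : manifold R n2) (M3 : manifold R n3)
    (g : form_field M1) (J1 : endo_field M1) (hM1 : almost_hermitian g J1)
    (i2 : M2 -> M1) (theta1 : M2 -> R)
    (hM2 : proper_pointwise_slant g J1 i2 theta1)
    (i3 : M3 -> M2) (theta2 : M3 -> R)
    (hM3 : pointwise_slant (induced_metric i2 g) (slant_endo g J1 i2 theta1)
                           i3 theta2) :
  let theta (x : M3) := acos (cos (theta1 (i3 x)) * cos (theta2 x)) in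
  pointwise_slant g J1 (i2 \o i3) theta /\
  forall x : M3, Num.max (theta1 (i3 x)) (theta2 x) <= theta x.
Proof.
move=> theta; have [sM2 proper] := hM2.
have [I2 range1 _] := sM2; have [I3 range2 _] := hM3.
have pi0 := pi_gt0 R.
have pih : pi / 2 <= pi :> R.
  by lra.
have c1gt0 x : 0 < cos (theta1 (i3 x)).
  have /andP[t0 tpi] := range1 (i3 x); apply: cos_gt0_pihalf.
  by apply/andP; split; [lra|rewrite lt_neqAle proper].
have c1lt1 x : cos (theta1 (i3 x)) < 1.
  have /andP[t0 tpi] := range1 (i3 x).
  by rewrite -cos0 ltr_cos // in_itv /=; apply/andP; split; lra.
have c2ge0 x : 0 <= cos (theta2 x).
  have /andP[t0 tpi] := range2 x; apply: cos_ge0_pihalf.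
  by apply/andP; split; lra.
have c_le1 x : cos (theta1 (i3 x)) * cos (theta2 x) <= cos (theta1 (i3 x)).
  by rewrite ler_piMr ?cos_le1 // ltW.
have c_le2 x : cos (theta1 (i3 x)) * cos (theta2 x) <= cos (theta2 x).
  by rewrite ler_piMl // ltW.
have c_ge0 x : 0 <= cos (theta1 (i3 x)) * cos (theta2 x).
  by rewrite mulr_ge0 // ltW.
split; last first.
  move=> x; have [/andP[t0 tpi] /andP[s0 spi]] := (range1 (i3 x), range2 x).
  have cN1 := le_trans (lerN10 R) (c_ge0 x).
  by rewrite ge_max !acos_ge ?in_itv /= ?(ltW t0) ?(ltW s0) ?(le_trans _ pih).
split=> [|x|x v v0]; first exact: injective_immersion_comp.
  by apply: acos_range; rewrite c_ge0 (le_lt_trans (c_le1 x)).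
have [gR JR _] := hM1; have [_ _ dI] := injective_immersion_comp I3 I2.
have ipg : inner_product (g (i2 (i3 x))) := metric_inner_product _ gR.
rewrite (angle_to_tangentE ipg (dI x)).
rewrite (gnorm_projection_comp hM1 sM2 hM3 (c1gt0 x) v0) mulfK //.
rewrite gt_eqF // (gnorm_gt0 ipg) //; apply: almost_complex_neq0 => //.
exact: tangent_map_neq0 (dI x) v0.
Qed.
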